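(* Let $\mathcal{P}$ be a fixed hyper-prior, $\delta>0$ and $\lambda>0$ fixed. Then with probability at least $1-\delta$ over the sampling of $S_1,\dots,S_n$, simultaneously for all hyper-posteriors $\mathcal{Q}$ and all posteriors $Q_1,\dots,Q_n$, $$-\frac M\lambda\log\Big(1-\mathcal{R}^S+\mathcal{R}^S e^{-\lambda/M}\Big)\;\le\;\widehat{\mathcal{R}}^S+\frac{\mathrm{KL}(\mathfrak{Q}\|\mathfrak{P})+\log\frac1\delta}{\lambda},$$ where $M=\sum_{i=1}^n m_i$, $\mathcal{R}^S=\sum_{i=1}^n\frac{m_i}{M}\mathcal{R}_i(Q_i)$ and $\widehat{\mathcal{R}}^S=\sum_{i=1}^n\frac{m_i}{M}\widehat{\mathcal{R}}_i(Q_i)$.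
   Context: Multi-task setting: $n$ tasks; task $i$ has an unknown distribution $D_i$ on $\mathcal{Z}$, a loss $\ell_i:\mathcal{F}\times\mathcal{Z}\to[0,1]$, and a training set $S_i=(z_{i1},\dots,z_{im_i})$ of $m_i\ge1$ i.i.d. samples from $D_i$, the $S_i$ mutually independent. $\mathcal{M}(\mathcal{F})$ is the set of probability distributions on $\mathcal{F}$. For $Q\in\mathcal{M}(\mathcal{F})$: $\ell_i(Q,z)=\mathbb{E}_{f\sim Q}\ell_i(f,z)$, $\mathcal{R}_i(Q)=\mathbb{E}_{z\sim D_i}\ell_i(Q,z)$, $\widehat{\mathcal{R}}_i(Q)=\frac1{m_i}\sum_{j=1}^{m_i}\ell_i(Q,z_{ij})$. Hyper-prior $\mathcal{P}$ (data-independent) and hyper-posterior $\mathcal{Q}$ are distributions on $\mathcal{M}(\mathcal{F})$; posteriors $Q_i\in\mathcal{M}(\mathcal{F})$; $\mathcal{Q},Q_i$ may depend on the data. $\mathfrak{Q}=\mathcal{Q}\times Q_1\times\cdots\times Q_n$ on $\mathcal{M}(\mathcal{F})\times\mathcal{F}^n$; $\mathfrak{P}$ on the same space is generated by $P\sim\mathcal{P}$, then $f_1,\dots,f_n$ i.i.d. $\sim P$. $\mathrm{KL}$ is the Kullback–Leibler divergence. *)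

(* Defs.v *)
From HB Require Import structures.
From mathcomp Require Import all_boot all_order all_algebra.
From mathcomp Require Import all_classical all_reals all_analysis.

Set Implicit Arguments.
Unset Strict Implicit.
Unset Printing Implicit Defensive.

Import Order.TTheory GRing.Theory Num.Theory.
Local Open Scope classical_set_scope.
Local Open Scope ring_scope.

Definition KL d (T : measurableType d) (R : realType)
  (mu nu : probability T R) : \bar R :=
  if pselect (mu `<< nu) then
    (\int[mu]_x (ln (fine (Radon_Nikodym (charge_of_finite_measure mu) nu x)))%:E)%E
  else (+oo)%E.

Section pac_bayes_defs.
Context (R : realType) (dF dZ : measure_display)
  (F : measurableType dF) (Z : measurableType dZ).

Definition lossQ (l : F -> Z -> R) (Q : probability F R) (z : Z) : R :=
  fine (\int[Q]_f (l f z)%:E)%E.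

Definition risk (D : probability Z R) (l : F -> Z -> R)
  (Q : probability F R) : R :=
  fine (\int[D]_z (lossQ l Q z)%:E)%E.

Definition emp_risk (m : nat) (l : F -> Z -> R) (Q : probability F R)
  (s : 'I_m -> Z) : R :=
  (m%:R)^-1 * \sum_(j < m) lossQ l Q (s j).

Definition rect n (B : set (pprobability F R)) (A : 'I_n -> set F) :
  set (pprobability F R * n.-tuple F)%type :=
  [set x | B x.1 /\ forall i, A i (tnth x.2 i)].

Definition is_hyper_product n (calQ : probability (pprobability F R) R)
  (Q : 'I_n -> probability F R)
  (frakQ : probability (pprobability F R * n.-tuple F)%type R) : Prop :=
  forall (B : set (pprobability F R)) (A : 'I_n -> set F),
    measurable B -> (forall i, measurable (A i)) ->
    fine (frakQ (rect B A)) = fine (calQ B) * \prod_(i < n) fine (Q i (A i)).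

(* frakP: P ~ calP, then f_0, ..., f_{n-1} i.i.d. ~ P, characterized on
   measurable rectangles *)
Definition is_hyper_mixture n (calP : probability (pprobability F R) R)
  (frakP : probability (pprobability F R * n.-tuple F)%type R) : Prop :=
  forall (B : set (pprobability F R)) (A : 'I_n -> set F),
    measurable B -> (forall i, measurable (A i)) ->
    frakP (rect B A) =
      (\int[calP]_(P in B) (\prod_(i < n) fine ((P : probability F R) (A i)))%:E)%E.

End pac_bayes_defs.

(* Main.v *)
Require Import Defs.
From HB Require Import structures.
From mathcomp Require Import all_boot all_order all_algebra.
From mathcomp Require Import all_classical all_reals all_analysis.
From mathcomp Require Import measurable_realfun.
From mathcomp Require Import ring lra.

(** For independent losses [L_k] in [[0, 1]] with means [r_k], convexity of [exp]
    gives [E exp (- a L_k) <= 1 - r_k (1 - exp (- a))], so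
    [V := prod_k exp (- a L_k) / (1 - r_k (1 - exp (- a)))] has expectation at
    most [1] over the sample.  By Tonelli this remains true after averaging over
    the prior, which does not depend on the sample, and by Markov's inequality
    that average is at most [1 / delta] outside an event of probability [delta].
    The Donsker-Varadhan inequality turns this into a bound on the mean of
    [ln V] under every posterior, at the price of a [KL] term.  Finally [ln]
    lies below its tangent at the averaged argument, which plays the part of
    Jensen's inequality over the tasks and over the posterior at once. *)

Set Implicit Arguments.
Unset Strict Implicit.
Unset Printing Implicit Defensive.

Import Order.TTheory GRing.Theory Num.Theory.
Local Open Scope classical_set_scope.
Local Open Scope ring_scope.

(** * Expectations of products of independent variables *)

Lemma measurable_forall_preimage d1 d2 (T1 : measurableType d1)
    (T2 : measurableType d2) (K : finType) (X : K -> T1 -> T2)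
    (A : K -> set T2) :
  (forall k, measurable_fun setT (X k)) -> (forall k, measurable (A k)) ->
  measurable [set w | forall k, A k (X k w)].
Proof.
move=> mX mA.
rewrite [X in measurable X](_ : _ = \bigcap_(k in [set: K]) (X k @^-1` A k)).
  apply: fin_bigcap_measurable => // k _.
  by rewrite -[X in measurable X]setTI; exact: mX.
by apply/seteqP; split=> w /= + k => /(_ k)// => /(_ I).
Qed.

Section independence.
Context (R : realType) (dO dZ : measure_display).
Context (Omega : measurableType dO) (Z : measurableType dZ).
Variable PS : probability Omega R.

Import HBNNSimple.

(** This separates one independent factor [g (X w)] from the rest [h w], whose mean is [c]. The
    factorization assumed for indicators passes to simple functions by linearity, and to nonnegative
    measurable [g] by monotone convergence along [nnsfun_approx]. *)
Lemma ge0_integralM_comp (mu : probability Z R) (X : Omega -> Z)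
    (h : Omega -> R) (c : R) (g : Z -> R) :
  measurable_fun setT X -> measurable_fun setT h -> (forall w, 0 <= h w) ->
  (forall B, measurable B ->
    (\int[PS]_w (h w * \1_B (X w))%:E = c%:E * mu B)%E) ->
  measurable_fun setT g -> (forall x, 0 <= g x) ->
  (\int[PS]_w (h w * g (X w))%:E = c%:E * \int[mu]_x (g x)%:E)%E.
Proof.
move=> mX mh h0 hc mg g0.
have mEg : measurable_fun setT (fun x => (g x)%:E) by exact/measurable_EFinP.
pose s := nnsfun_approx measurableT mEg.
have sg x : (EFin \o s n) x @[n --> \oo] --> (g x)%:E.
  by apply: (@cvg_nnsfun_approx _ _ _ _ measurableT _ mEg) => // y _; rewrite lee_fin.
have nds x a b : (a <= b)%N -> s a x <= s b x.
  by move=> ab; exact/lefP/nd_nnsfun_approx.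
transitivity (limn (fun n => \int[PS]_w (h w * s n (X w))%:E))%E.
  rewrite -monotone_convergence//.
  - apply: eq_integral => w _; apply/esym/cvg_lim => //.
    under eq_fun do rewrite EFinM.
    by rewrite EFinM; apply: cvgeZl => //; exact: sg.
  - move=> n; apply/measurable_EFinP/measurable_funM => //.
    exact: measurableT_comp.
  - by move=> n w _; rewrite lee_fin mulr_ge0.
  - move=> w _ a b ab; rewrite lee_fin ler_wpM2l//.
    exact: nds.
transitivity (limn (fun n => c%:E * \int[mu]_x (s n x)%:E))%E; last first.
  rewrite limeMl//.
    congr (_ * _)%E; rewrite -monotone_convergence//.
    - by apply: eq_integral => x _; apply/cvg_lim => //; exact: sg.
    - by move=> n; exact/measurable_EFinP.
    - by move=> n x _; rewrite lee_fin.
    - by move=> x _ a b ab; rewrite lee_fin; exact: nds.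
  apply: ereal_nondecreasing_is_cvgn => a b ab; apply: ge0_le_integral => //.
  - by move=> x _; rewrite lee_fin.
  - exact/measurable_EFinP.
  - exact/measurable_EFinP.
  - by move=> x _; rewrite lee_fin; exact: nds.
congr (limn _); apply/funext => n.
have mind r : measurable_fun setT (fun w => \1_(s n @^-1` [set r]) (X w) : R).
  exact: measurableT_comp.
(* With [B] the whole space, [hc] identifies [c] as the integral of [h]. *)
have c0 : 0 <= c.
  have := hc setT measurableT; rewrite probability_setT mule1 => hc1.
  by rewrite -lee_fin -hc1; apply: integral_ge0 => w _; rewrite lee_fin mulr_ge0.
transitivity (\sum_(y \in range (s n))
    \int[PS]_w (y * (h w * \1_(s n @^-1` [set y]) (X w)))%:E)%E.
  under eq_integral.
    move=> w _; rewrite EFinM fimfunE -fsumEFin//.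
    rewrite ge0_mule_fsumr; last by move=> r; exact: nnfun_muleindic_ge0.
    under eq_fsbigr do rewrite -EFinM mulrCA.
    over.
  rewrite ge0_integral_fsum//.
  - move=> r; apply/measurable_EFinP/measurable_funM => //.
    exact: measurable_funM.
  - move=> r w _; rewrite mulrCA EFinM mule_ge0 ?lee_fin//.
    exact: (nnfun_muleindic_ge0 (s n)).
transitivity (c%:E * \sum_(y \in range (s n))
    \int[mu]_x (y * \1_(s n @^-1` [set y]) x)%:E)%E; last first.
  congr (_ * _)%E; under [RHS]eq_integral do rewrite fimfunE -fsumEFin//.
  rewrite ge0_integral_fsum//.
  - by move=> r; apply/measurable_EFinP/measurable_funM.
  - by move=> r x _; exact: nnfun_muleindic_ge0.
rewrite ge0_mule_fsumr; last first.
  by move=> r; apply: integral_ge0 => x _; exact: nnfun_muleindic_ge0.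
apply: eq_fsbigr => r /[!inE] -[x _ <-].
under eq_integral do rewrite EFinM.
rewrite ge0_integralZl//; last 3 first.
- by apply/measurable_EFinP/measurable_funM.
- by move=> w _; rewrite lee_fin mulr_ge0.
- by rewrite lee_fin.
rewrite hc//; under [in RHS]eq_integral do rewrite EFinM.
rewrite ge0_integralZl//; last 2 first.
- exact/measurable_EFinP.
- by rewrite lee_fin.
by rewrite integral_indic// setIT muleCA.
Qed.

Context (K : finType) (X : K -> Omega -> Z) (mu : K -> probability Z R).
Hypothesis mX : forall k, measurable_fun setT (X k).
Hypothesis indepX : forall A : K -> set Z, (forall k, measurable (A k)) ->
  PS [set w | forall k, A k (X k w)] = (\prod_k fine (mu k (A k)))%:E.

(** Independence is the case where every factor is an indicator. The indicators are exchanged for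
    general functions one index at a time. *)
Lemma integral_prod_indep (g : K -> Z -> R) :
  (forall k, measurable_fun setT (g k)) -> (forall k x, 0 <= g k x) ->
  (forall k, (mu k).-integrable setT (EFin \o g k)) ->
  (\int[PS]_w (\prod_k g k (X k w))%:E)%E =
    (\prod_k \int[mu k]_x g k x)%:E.
Proof.
(* The list [s] holds the indices whose factor may be arbitrary; all other factors are indicators.
   The induction is on [s]. *)
suff ind (s : seq K) : forall g : K -> Z -> R,
    (forall k, k \notin s -> exists2 A, measurable A & g k = \1_A) ->
    (forall k, measurable_fun setT (g k)) -> (forall k x, 0 <= g k x) ->
    (forall k, (mu k).-integrable setT (EFin \o g k)) ->
    (\int[PS]_w (\prod_k g k (X k w))%:E)%E =
      (\prod_k \int[mu k]_x g k x)%:E.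
  by apply: (ind (enum K)) => k; rewrite mem_enum.
elim: s => [|k0 s IH] {}g gs mg g0 ig.
  have /choice[A gA] : forall k, exists A, measurable A /\ g k = \1_A.
    by move=> k; have [//|A mA gA] := gs k; exists A.
  have mA k := (gA k).1.
  set E := [set w | forall k, A k (X k w)].
  have mE : measurable E by exact: measurable_forall_preimage.
  transitivity (PS E).
    rewrite -[E in RHS]setIT -integral_indic//.
    apply: eq_integral => w _; congr EFin; rewrite indicE.
    under eq_bigr do rewrite (gA _).2 indicE.
    have [wE|] := boolP (w \in E).
      by rewrite big1// => k _; rewrite mem_set//; move/set_mem : wE; exact.
    rewrite notin_setE => /existsNP[k wk].
    by rewrite (bigD1 k)//= memNset// mul0r.
  rewrite indepX//; congr EFin; apply: eq_bigr => k _.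
  by rewrite (gA k).2 /Rintegral integral_indic// setIT.
set h := fun w => \prod_(k | k != k0) g k (X k w).
have mh : measurable_fun setT h.
  rewrite /h; under eq_fun do rewrite -big_filter.
  apply: measurable_prod => k _.
  exact: measurableT_comp (mg k) (mX k).
under eq_integral do rewrite (bigD1 k0)//= mulrC.
rewrite (@ge0_integralM_comp (mu k0) (X k0) h
  (\prod_(k | k != k0) \int[mu k]_x g k x))//.
- rewrite [in RHS](bigD1 k0)//= mulrC EFinM /Rintegral.
  by rewrite fineK//; have := integrable_fin_num measurableT (ig k0).
- by move=> w; apply: prodr_ge0.
- move=> B mB.
  (* With the factor at [k0] replaced by [\1_B], the induction hypothesis applies and yields the
     factorization over indicators that [ge0_integralM_comp] asks for. *)
  pose g' k := if k == k0 then \1_B else g k.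
  transitivity (\int[PS]_w (\prod_k g' k (X k w))%:E)%E.
    apply: eq_integral => w _; rewrite (bigD1 k0)//= mulrC /g' eqxx.
    by congr (_ * _)%:E; apply: eq_bigr => k /negbTE ->.
  rewrite IH.
  - rewrite (bigD1 k0)//= mulrC EFinM /g' eqxx; congr (_%:E * _)%E.
      by apply: eq_bigr => k /negbTE ->.
    by rewrite /Rintegral integral_indic// setIT fineK// fin_num_measure.
  - move=> k ks; rewrite /g'; case: eqVneq => [_|kk0]; first by exists B.
    by apply: gs; rewrite inE negb_or kk0.
  - by move=> k; rewrite /g'; case: ifP.
  - by move=> k x; rewrite /g'; case: ifP.
  - move=> k; rewrite /g'; case: ifP => // _.
    exact: integrable_indic.
Qed.

End independence.

(** * Change of measure *)

(** Positive and negative parts are compared separately, so no integrability is required. This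
    matters for the log-density, whose integral may be [+oo]. *)
Lemma le_integral_measurable d (T : measurableType d) (R : realType)
    (mu : {measure set T -> \bar R}) (f g : T -> \bar R) :
  measurable_fun setT f -> measurable_fun setT g ->
  (forall x, (f x <= g x)%E) -> (\int[mu]_x f x <= \int[mu]_x g x)%E.
Proof.
move=> mf mg fg; rewrite integralE [leRHS]integralE; apply: leeB.
- apply: ge0_le_integral; [by []|by []|exact: measurable_funepos|
    exact: measurable_funepos|by move=> x _; exact: (funepos_le (D:=setT) (fun y _ => fg y) (in_setT x))].
- apply: ge0_le_integral; [by []|by []|exact: measurable_funeneg|
    exact: measurable_funeneg|by move=> x _; exact: (funeneg_le (D:=setT) (fun y _ => fg y) (in_setT x))].
Qed.

(** With [h] the density of [Q] with respect to [P], the function [X = exp phi / (C h)] has [Q]-mean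
    at most [1]. The inequality [1 + u <= exp u] at [u = phi - ln C - ln h] gives
    [phi - ln C + 1 - X <= ln h], which is then integrated against [Q]. Without absolute continuity
    the right-hand side is [+oo]. *)
Lemma KL_variational d (T : measurableType d) (R : realType)
    (Q P : probability T R) (phi : T -> R) (C : R) :
  Q.-integrable setT (EFin \o phi) -> 0 < C ->
  (\int[P]_x (expR (phi x))%:E <= C%:E)%E ->
  ((\int[Q]_x phi x)%:E <= KL Q P + (ln C)%:E)%E.
Proof.
move=> iphi C0 expC; rewrite /KL; case: pselect => [QP|nQP] /=; last first.
  by rewrite addye// leey.
set rn := Radon_Nikodym _ _.
have irn : P.-integrable setT rn by exact: Radon_Nikodym_integrable.
have mrn : measurable_fun setT rn by exact: measurable_int irn.
have frn x : rn x \is a fin_num by exact: Radon_Nikodym_fin_num.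
pose h x := fine (rn x).
have mh : measurable_fun setT h by exact: measurableT_comp.
have mphi : measurable_fun setT phi.
  by apply/measurable_EFinP; exact: measurable_int iphi.
(* On [N] the value of [ln (h x)] is only a default. [Q] gives [N] no mass, because [Q N] is the
   integral over [N] of a nonpositive density. *)
pose N := [set x | h x <= 0].
have mN : measurable N.
  by rewrite -[N]setTI; exact: measurable_fun_le.
have QN : Q N = 0.
  apply/eqP; rewrite eq_le measure_ge0 andbT.
  rewrite [leLHS](_ : _ = \int[P]_(x in N) rn x)%E; last first.
    by rewrite -Radon_Nikodym_integral.
  rewrite (eq_integral (fun x => - - rn x)%E); last by move=> x _; rewrite oppeK.
  rewrite integral_ge0N; last first.
    by move=> x Nx; rewrite oppe_ge0 -(fineK (frn x)) lee_fin.
  rewrite oppe_le0; apply: integral_ge0 => x Nx.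
  by rewrite oppe_ge0 -(fineK (frn x)) lee_fin.
pose X x := if 0 < h x then expR (phi x - ln C - ln (h x)) else 0.
have mX : measurable_fun setT X.
  apply: measurable_fun_ifT => //; first exact: measurable_fun_ltr.
  apply: measurableT_comp => //; apply: measurable_funB.
    exact: measurable_funB.
  exact: measurableT_comp.
have X0 x : 0 <= X x.
  by rewrite /X; case: ifPn => // hx; rewrite expR_ge0.
have XQ : (\int[Q]_x (X x)%:E <= 1)%E.
  (* The change of variables uses another version of the density, equal to [rn] outside a [P]-null
     set. *)
  rewrite -(Radon_Nikodym_SigmaFinite.change_of_variables QP)//; last exact/measurable_EFinP.
  rewrite (@ae_eq_integral _ _ _ P setT (fun x => (X x)%:E * rn x)%E)//; last 3 first.
  - apply: emeasurable_funM; first exact/measurable_EFinP.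
    exact: measurable_int (Radon_Nikodym_SigmaFinite.f_integrable QP).
  - by apply: emeasurable_funM => //; exact/measurable_EFinP.
  - exact/ae_eqe_mul2l/ae_eq_Radon_Nikodym_SigmaFinite.
  have XrnE x : ((X x)%:E * rn x <= (C^-1 * expR (phi x))%:E)%E.
    rewrite -(fineK (frn x)) -EFinM lee_fin -/(h x) /X.
    case: ifPn => [hx|_]; last by rewrite mul0r mulr_ge0 ?expR_ge0 ?invr_ge0 ?ltW.
    by rewrite !expRD !expRN !lnK ?posrE// mulrVK ?unitfE ?gt_eqF// mulrC.
  apply: (@le_trans _ _ (\int[P]_x (C^-1 * expR (phi x))%:E)%E).
    apply: le_integral_measurable => //.
    + by apply: emeasurable_funM => //; exact/measurable_EFinP.
    + apply/measurable_EFinP/measurable_funM => //.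
      exact: measurableT_comp.
  under eq_integral do rewrite EFinM.
  rewrite ge0_integralZl//; last 2 first.
  - exact/measurable_EFinP/measurableT_comp.
  - by rewrite lee_fin invr_ge0 ltW.
  by rewrite -lee_pdivlMl ?invr_gt0// invrK mule1.
have iX : Q.-integrable setT (EFin \o X).
  apply/integrableP; split; first exact/measurable_EFinP.
  under eq_integral do rewrite /= ger0_norm//.
  exact: le_lt_trans XQ (ltry _).
pose g x := phi x + (- ln C + 1) - X x.
have iC : Q.-integrable setT (EFin \o (fun=> - ln C + 1)).
  exact: finite_measure_integrable_cst.
have ig1 : Q.-integrable setT (EFin \o (fun x => phi x + (- ln C + 1))).
  exact: (integrableD measurableT iphi iC).
have mg : measurable_fun setT g.
  by apply: measurable_funB => //; apply: measurable_funD.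
(* [k] differs from [ln (h x)] only on the null set [N], where it is set to [g x] so that [g <= k]
   holds at every point. *)
pose k x := if 0 < h x then ln (h x) else g x.
have mk : measurable_fun setT k.
  apply: measurable_fun_ifT => //; first exact: measurable_fun_ltr.
  exact: measurableT_comp.
have -> : (\int[Q]_x (ln (h x))%:E = \int[Q]_x (k x)%:E)%E.
  apply: ae_eq_integral => //.
  - by apply/measurable_EFinP; exact: measurableT_comp.
  - exact/measurable_EFinP.
  - exists N; split => // x; apply: contra_notP => /negP; rewrite -ltNge => hx _.
    by rewrite /k hx.
have : (\int[Q]_x (g x)%:E <= \int[Q]_x (k x)%:E)%E.
  apply: le_integral_measurable; [exact/measurable_EFinP..|] => x.
  rewrite lee_fin /k; case: ifPn => // hx; rewrite /g /X hx.
  have := expR_ge1Dx (phi x - ln C - ln (h x)); lra.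
have -> : (\int[Q]_x (g x)%:E)%E = (\int[Q]_x phi x - ln C + 1 - \int[Q]_x X x)%:E.
  rewrite -(@fineK _ (\int[Q]_x (g x)%:E)%E); last first.
    apply: integrable_fin_num => //.
    exact: (integrableB measurableT ig1 iX).
  congr EFin.
  transitivity (\int[Q]_x (phi x + (- ln C + 1) - X x)); first by [].
  rewrite RintegralB// RintegralD// Rintegral_cst//.
  by rewrite [X in fine X](probability_setT Q) mulr1 addrA.
have X1 : \int[Q]_x X x <= 1.
  by rewrite -lee_fin /Rintegral fineK//; exact: integrable_fin_num.
move=> gk; rewrite -leeBlDr//; apply: le_trans gk; rewrite lee_fin; lra.
Qed.

(** * The chord of the exponential, and integrals of bounded functions *)

(** The point [- (a * x)] is the convex combination of [- a] and [0] with weights [x] and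
    [1 - x]. *)
Lemma expR_le_chord (R : realType) (a x : R) : 0 <= x <= 1 ->
  expR (- (a * x)) <= 1 - x * (1 - expR (- a)).
Proof.
move=> /andP[x0 x1]; have := @convex_expR R (Itv01 x0 x1) (- a) 0.
rewrite !convRE/= expR0 /unstable.onem mulr0 addr0 mulrN (mulrC x a).
by move=> /le_trans; apply; rewrite mulrBr !mulr1; lra.
Qed.

Lemma integrable01 d (T : measurableType d) (R : realType)
    (P : probability T R) (f : T -> R) :
  measurable_fun setT f -> (forall x, 0 <= f x <= 1) ->
  P.-integrable setT (EFin \o f).
Proof.
move=> mf f01.
apply: (@le_integrable _ _ _ P setT measurableT _ (EFin \o (fun=> 1))).
- exact/measurable_EFinP.
- move=> x _ /=; rewrite lee_fin normr1.
  by have /andP[f0 f1] := f01 x; rewrite ger0_norm.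
- exact: finite_measure_integrable_cst.
Qed.

Lemma Rintegral01 d (T : measurableType d) (R : realType)
    (P : probability T R) (f : T -> R) :
  measurable_fun setT f -> (forall x, 0 <= f x <= 1) ->
  0 <= \int[P]_x f x <= 1.
Proof.
move=> mf f01; rewrite Rintegral_ge0/=; last by move=> x _; have /andP[] := f01 x.
have -> : 1 = \int[P]_x 1.
  by rewrite Rintegral_cst// mul1r [X in fine X](probability_setT P).
apply: le_Rintegral => //.
- exact: integrable01.
- exact: finite_measure_integrable_cst.
- by move=> x _; have /andP[] := f01 x.
Qed.

Lemma measurable_Rintegral2 d1 d2 (T1 : measurableType d1)
    (T2 : measurableType d2) (R : realType) (P : probability T2 R)
    (f : T1 -> T2 -> R) :
  measurable_fun [set: (T1 * T2)%type] (fun p => f p.1 p.2) ->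
  (forall x y, 0 <= f x y) ->
  measurable_fun setT (fun x => \int[P]_y f x y).
Proof.
move=> mf f0; apply: measurableT_comp => //.
apply: (@measurable_fun_fubini_tonelli_F _ _ _ _ _ P (fun p => (f p.1 p.2)%:E)).
- exact/measurable_EFinP.
- by move=> p; rewrite lee_fin.
Qed.

Lemma Rintegral_sum d (T : measurableType d) (R : realType)
    (P : probability T R) (I : finType) (f : I -> T -> R) :
  (forall i, P.-integrable setT (EFin \o f i)) ->
  \int[P]_x (\sum_i f i x) = \sum_i \int[P]_x f i x.
Proof.
move=> fi; rewrite /Rintegral.
under eq_integral do rewrite -sumEFin.
rewrite integral_sum// sum_fine// => i _.
exact: (integrable_fin_num measurableT (fi i)).
Qed.

Lemma integrable_affine d (T : measurableType d) (R : realType)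
    (P : probability T R) (c e : R) (f : T -> R) :
  P.-integrable setT (EFin \o f) ->
  P.-integrable setT (EFin \o (fun x => c + e * f x)).
Proof.
move=> fi.
exact: (integrableD measurableT (finite_measure_integrable_cst P c measurableT)
  (integrableZl measurableT e fi)).
Qed.

Lemma Rintegral_affine d (T : measurableType d) (R : realType)
    (P : probability T R) (c e : R) (f : T -> R) :
  P.-integrable setT (EFin \o f) ->
  \int[P]_x (c + e * f x) = c + e * \int[P]_x f x.
Proof.
move=> fi; rewrite RintegralD//; last exact: (integrableZl measurableT e fi).
  by rewrite Rintegral_cst// [X in fine X](probability_setT P) mulr1 RintegralZl.
exact: (finite_measure_integrable_cst P c measurableT).
Qed.

(** * The bound for one finite family of independent losses over a parameter space [T] *)

Section catoni.
Context (R : realType) (dT dZ dO : measure_display).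
Context (T : measurableType dT) (Z : measurableType dZ).
Context (Omega : measurableType dO) (PS : probability Omega R).
Context (K : finType) (X : K -> Omega -> Z) (mu : K -> probability Z R).
Hypothesis mX : forall k, measurable_fun setT (X k).
Hypothesis indepX : forall A : K -> set Z, (forall k, measurable (A k)) ->
  PS [set w | forall k, A k (X k w)] = (\prod_k fine (mu k (A k)))%:E.
Variable L : K -> T -> Z -> R.
Hypothesis mL : forall k,
  measurable_fun [set: (T * Z)%type] (fun p => L k p.1 p.2).
Hypothesis L01 : forall k t z, 0 <= L k t z <= 1.
Variable a : R.

(** With this [b], [1 - r * b] is the moment generating function at [- a] of a Bernoulli variable of
    mean [r]. *)
Let b := 1 - expR (- a).

Let chord_gt0 (x : R) : 0 <= x <= 1 -> 0 < 1 - x * b.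
Proof.
move=> x01; apply: lt_le_trans (expR_le_chord a x01); exact: expR_gt0.
Qed.

Let risk k t := \int[mu k]_z L k t z.

Let mLt k t : measurable_fun setT (L k t).
Proof. exact: measurableT_comp (mL k) (pair1_measurable t). Qed.

Let mLz k z : measurable_fun setT (L k ^~ z).
Proof. exact: measurableT_comp (mL k) (pair2_measurable z). Qed.

Let risk01 k t : 0 <= risk k t <= 1.
Proof. by apply: Rintegral01. Qed.

Let mrisk k : measurable_fun setT (risk k).
Proof.
by apply: measurable_Rintegral2 => // t z; have /andP[] := L01 k t z.
Qed.

(** This is one factor of the product [V]. The denominator is kept inside the exponential so that
    the product over [k] is the exponential of the sum [W]. *)
Let normalized_mgf k t z := expR (- (a * L k t z) - ln (1 - risk k t * b)).

(** The chord bound divided by [1 - risk k t * b] is affine in the loss. It provides an integrable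
    majorant, and its mean is exactly [1]. *)
Let normalized_mgf_le k t z :
  normalized_mgf k t z <= (1 - risk k t * b)^-1 + - (b / (1 - risk k t * b)) * L k t z.
Proof.
rewrite /normalized_mgf expRD (expRN (ln _)) lnK ?posrE ?chord_gt0//.
apply: (@le_trans _ _ ((1 - L k t z * b) * (1 - risk k t * b)^-1)).
  by rewrite ler_pM2r ?invr_gt0 ?chord_gt0// expR_le_chord.
by rewrite le_eqVlt; apply/orP; left; apply/eqP; ring.
Qed.

Let mnormalized_mgf k t : measurable_fun setT (normalized_mgf k t).
Proof.
apply: measurableT_comp => //; apply: measurable_funB => //.
apply: measurableT_comp => //; exact: measurable_funM.
Qed.

Let integrable_normalized_mgf k t :
  (mu k).-integrable setT (EFin \o normalized_mgf k t).
Proof.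
have iL := integrable01 (mu k) (mLt k t) (L01 k t).
apply: le_integrable (integrable_affine (1 - risk k t * b)^-1
  (- (b / (1 - risk k t * b))) iL) => //; first exact/measurable_EFinP.
move=> z _ /=; rewrite lee_fin ger0_norm ?expR_ge0//.
exact: le_trans (normalized_mgf_le k t z) (ler_norm _).
Qed.

Let Rintegral_normalized_mgf_le1 k t :
  0 <= \int[mu k]_z normalized_mgf k t z <= 1.
Proof.
rewrite Rintegral_ge0 /=; last by move=> z _; exact: expR_ge0.
have iL := integrable01 (mu k) (mLt k t) (L01 k t).
apply: le_trans (_ : _ <= \int[mu k]_z ((1 - risk k t * b)^-1 +
    - (b / (1 - risk k t * b)) * L k t z)) _.
  apply: le_Rintegral => //; first exact: integrable_normalized_mgf.
  exact: (integrable_affine _ _ iL).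
rewrite Rintegral_affine// -/(risk k t).
have := chord_gt0 (risk01 k t); set q := risk k t => q0.
by rewrite le_eqVlt; apply/orP; left; apply/eqP; field; rewrite gt_eqF.
Qed.

Let W t w := \sum_k (- (a * L k t (X k w)) - ln (1 - risk k t * b)).

Let mW : measurable_fun [set: (T * Omega)%type] (fun p => W p.1 p.2).
Proof.
apply: measurable_sum => k; apply: measurable_funB.
- apply: measurableT_comp => //; apply: measurable_funM => //.
  apply: (measurableT_comp (mL k)
    (g := fun p : T * Omega => (p.1, X k p.2))).
  apply: measurable_fun_pair => //; exact: measurableT_comp.
- apply: measurableT_comp => //; apply: measurable_funB => //.
  apply: measurable_funM => //; exact: measurableT_comp.
Qed.

Let integral_expW_le1 t : (\int[PS]_w (expR (W t w))%:E <= 1)%E.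
Proof.
under eq_integral do rewrite /W expR_sum.
rewrite (integral_prod_indep mX indepX (g := normalized_mgf ^~ t))//.
- rewrite lee_fin; apply: prodr_ile1 => k _; exact: Rintegral_normalized_mgf_le1.
- by move=> k z; exact: expR_ge0.
Qed.

(** The event is fixed by [P] and [delta] alone. All [Q] are then covered at once, since the
    variational inequality is applied separately at each sample [w] of the event. *)
Lemma catoni_bound (P : probability T R) (delta : R) : 0 < delta ->
  exists E : set Omega, [/\ measurable E, (PS E >= (1 - delta)%:E)%E &
    forall w, E w -> forall Q : probability T R,
    let rbar := #|K|%:R^-1 * \sum_k \int[Q]_t risk k t in
    ((- (#|K|%:R * ln (1 - rbar + rbar * expR (- a))))%:E <=
     (a * \sum_k \int[Q]_t L k t (X k w))%:E +
       (KL Q P + (ln delta^-1)%:E))%E].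
Proof.
move=> delta0.
pose G w := (\int[P]_t (expR (W t w))%:E)%E.
have mexpW : measurable_fun [set: (T * Omega)%type]
    (fun p => (expR (W p.1 p.2))%:E).
  by apply/measurable_EFinP; exact: measurableT_comp.
have mG : measurable_fun setT G.
  apply: (@measurable_fun_fubini_tonelli_G _ _ _ _ _ P
    (fun p => (expR (W p.1 p.2))%:E)) => //.
have G0 w : (0 <= G w)%E.
  by apply: integral_ge0 => t _; rewrite lee_fin expR_ge0.
have intG : (\int[PS]_w G w <= 1)%E.
  rewrite -(@fubini_tonelli _ _ _ _ _ P PS (fun p => (expR (W p.1 p.2))%:E))//=.
    apply: (@le_trans _ _ (\int[P]_t cst 1 t)%E).
      apply: le_integral_measurable => //.
      apply: (@measurable_fun_fubini_tonelli_F _ _ _ _ _ PS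
        (fun p => (expR (W p.1 p.2))%:E)) => //.
    by rewrite integral_cst// mul1e; exact: probability_le1.
(* Markov's inequality for [G], whose mean is at most [1], bounds the probability of the complement
   by [delta]. *)
pose E := [set w | (G w <= (delta^-1)%:E)%E].
have mE : measurable E by rewrite -[E]setTI; exact: measurable_lee.
exists E; split => //.
  have mCE := measurableC mE.
  have : ((delta^-1)%:E * PS (~` E) <= 1)%E.
    apply: le_trans intG.
    rewrite -integral_cst//; apply: (@le_trans _ _ (\int[PS]_(w in ~` E) G w)%E).
      apply: ge0_le_integral => //.
      + by move=> w _; rewrite lee_fin invr_ge0 ltW.
      + exact: measurable_funTS.
      + by move=> w /negP; rewrite -ltNge => /ltW.
    exact: ge0_subset_integral.
  rewrite lee_pdivrMl// mule1 probability_setC//.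
  rewrite -(@fineK _ (PS E)) ?fin_num_measure// -EFinB !lee_fin; lra.
move=> w Ew Q /=; set rbar := _^-1 * _.
pose r k := \int[Q]_t risk k t.
pose l k := \int[Q]_t L k t (X k w).
(* For empty [K] the inverse of [0] is [0] by default, and both sides vanish. *)
have KrbarE : #|K|%:R * rbar = \sum_k r k.
  have [K0|K0] := eqVneq #|K| 0%N; last by rewrite /rbar mulVKf ?pnatr_eq0.
  by rewrite K0 mul0r big_pred0// => k; have := card0_eq K0 k.
have rbar01 : 0 <= rbar <= 1.
  have r01 k : 0 <= r k <= 1 by exact: Rintegral01.
  rewrite mulr_ge0 ?invr_ge0 ?sumr_ge0//=; last by move=> k _; have /andP[] := r01 k.
  have [K0|K0] := posnP #|K|; first by rewrite /rbar K0 invr0 mul0r.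
  rewrite ler_pdivrMl ?ltr0n// mulr1 -sumr_const.
  by apply: ler_sum => k _; have /andP[] := r01 k.
pose A := 1 - rbar * b.
have A0 : 0 < A by exact: chord_gt0.
have -> : 1 - rbar + rbar * expR (- a) = A by rewrite /A /b; ring.
(* [ln] lies below its tangent at [A], which makes [W] dominate a function
   [phi] that is affine in the losses and the risks. *)
pose phi t :=
  \sum_k ((1 - ln A - A^-1 + b / A * risk k t) + - a * L k t (X k w)).
have ir k : Q.-integrable setT (EFin \o risk k) by exact: integrable01.
have il k : Q.-integrable setT (EFin \o (fun t => L k t (X k w))).
  by apply: integrable01.
have iphik k : Q.-integrable setT (EFin \o (fun t =>
    (1 - ln A - A^-1 + b / A * risk k t) + - a * L k t (X k w))).
  exact: (integrableD measurableT (integrable_affine _ _ (ir k))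
    (integrableZl measurableT (- a) (il k))).
have iphi : Q.-integrable setT (EFin \o phi).
  rewrite (_ : _ \o _ = (fun t => \sum_k ((1 - ln A - A^-1 + b / A * risk k t) +
      - a * L k t (X k w))%:E)%E); last by apply/funext => t; rewrite /= -sumEFin.
  by apply: integrable_sum => // k _; exact: iphik.
have mphi : measurable_fun setT phi.
  by apply/measurable_EFinP; exact: measurable_int iphi.
have phiW t : phi t <= W t w.
  apply: ler_sum => k _; rewrite addrC mulNr lerD2l.
  have dk := chord_gt0 (risk01 k t).
  have : ln (1 + ((1 - risk k t * b) / A - 1)) <= (1 - risk k t * b) / A - 1.
    by apply: le_ln1Dx; rewrite ltrBrDr addrC subrr divr_gt0.
  rewrite addrC subrK ln_div ?posrE// mulrBl mul1r; lra.
(* Since [A = 1 - rbar * b], the tangent terms cancel on average: [1 - A^-1 + b / A * rbar = 0].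
   Only [- ln A] is left for each [k]. *)
have Iphi : \int[Q]_t phi t = - (#|K|%:R * ln A) - a * \sum_k l k.
  rewrite Rintegral_sum//.
  under eq_bigr => k _.
    rewrite RintegralD//; last 2 first.
    - exact: integrable_affine.
    - exact: (integrableZl measurableT _ (il k)).
    rewrite Rintegral_affine// RintegralZl//; over.
  rewrite !big_split/= -!mulr_sumr !sumr_const -KrbarE /A.
  field; rewrite -/A gt_eqF//.
(* The variational inequality is applied to [phi] rather than [W]: its [Q]-mean is explicit, and
   [phi <= W] preserves the exponential bound valid on [E]. *)
have Cphi : (\int[P]_t (expR (phi t))%:E <= (delta^-1)%:E)%E.
  apply: le_trans Ew; apply: le_integral_measurable.
  - by apply/measurable_EFinP; exact: measurableT_comp.
  - exact: measurableT_comp mexpW (pair2_measurable w).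
  - by move=> t; rewrite lee_fin ler_expR.
have := KL_variational iphi _ Cphi; rewrite invr_gt0 => /(_ delta0).
by rewrite Iphi EFinB leeBlDl.
Qed.

End catoni.

(** * Exchange of integrals and marginals of the hyper-product *)

Lemma Rintegral_swap d1 d2 (T1 : measurableType d1) (T2 : measurableType d2)
    (R : realType) (P1 : probability T1 R) (P2 : probability T2 R)
    (f : T1 -> T2 -> R) :
  measurable_fun [set: (T1 * T2)%type] (fun p => f p.1 p.2) ->
  (forall x y, 0 <= f x y <= 1) ->
  \int[P1]_x \int[P2]_y f x y = \int[P2]_y \int[P1]_x f x y.
Proof.
move=> mf f01; rewrite /Rintegral; congr fine.
have f1 x : P2.-integrable setT (EFin \o f x).
  by apply: integrable01 => //; exact: measurableT_comp mf (pair1_measurable x).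
have f2 y : P1.-integrable setT (EFin \o f^~ y).
  by apply: integrable01 => //; exact: measurableT_comp mf (pair2_measurable y).
under eq_integral do rewrite fineK ?(integrable_fin_num measurableT (f1 _))//.
under [RHS]eq_integral do
  rewrite fineK ?(integrable_fin_num measurableT (f2 _))//.
apply: (@fubini_tonelli _ _ _ _ _ P1 P2 (fun p => (f p.1 p.2)%:E)).
- exact/measurable_EFinP.
- by move=> p; rewrite lee_fin; have /andP[] := f01 p.1 p.2.
Qed.

(** The law of the [i]-th function under [frakQ] is [Q i], as seen on rectangles whose sides other
    than the [i]-th are the whole space. *)
Lemma hyper_product_Rintegral (R : realType) (dF : measure_display)
    (F : measurableType dF) (n : nat) (calQ : probability (pprobability F R) R)
    (Q : 'I_n -> probability F R)
    (frakQ : probability (pprobability F R * n.-tuple F)%type R)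
    (i : 'I_n) (g : F -> R) :
  is_hyper_product calQ Q frakQ ->
  measurable_fun setT g -> (forall f, 0 <= g f) ->
  \int[frakQ]_t g (tnth t.2 i) = \int[Q i]_f g f.
Proof.
move=> QE mg g0; rewrite /Rintegral; congr fine.
pose pr (t : (pprobability F R * n.-tuple F)%type) := tnth t.2 i.
have mpr : measurable_fun setT pr.
  exact: measurableT_comp (measurable_tnth i) measurable_snd.
have -> : (\int[Q i]_f (g f)%:E = \int[pushforward frakQ pr]_f (g f)%:E)%E.
  apply: eq_measure_integral => A mA _.
  pose A' j := if j == i then A else setT.
  have mA' j : measurable (A' j) by rewrite /A'; case: ifP.
  have prA : pr @^-1` A = rect setT A'.
    apply/seteqP; split=> t /=.
      by move=> tA; split=> // j; rewrite /A'; case: eqP => // ->.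
    by move=> -[_ /(_ i)]; rewrite /A' eqxx.
  transitivity (frakQ (rect setT A')); last by rewrite -prA.
  have QA : fine (frakQ (rect setT A')) = fine (Q i A).
    rewrite QE// probability_setT mul1r (bigD1 i)//= big1 ?mulr1.
      by rewrite /A' eqxx.
    by move=> j /negbTE ji; rewrite /A' ji probability_setT.
  (* [is_hyper_product] equates real parts only; measurability of the rectangle makes its measure
     finite and so gives the equality in the extended reals. *)
  have mrect : measurable (rect [set: pprobability F R] A').
    have := mpr measurableT A mA; rewrite setTI => mprA.
    by rewrite -prA.
  by rewrite -(fineK (fin_num_measure frakQ _ mrect)) QA fineK// fin_num_measure.
rewrite ge0_integral_pushforward//; first exact/measurable_EFinP.
by move=> f _; rewrite lee_fin.
Qed.

(** * The multi-task bound *)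

Theorem theorem5
  (R : realType) (dF dZ dO : measure_display)
  (F : measurableType dF) (Z : measurableType dZ)
  (n : nat)
  (D : 'I_n -> probability Z R)
  (loss : 'I_n -> F -> Z -> R)
  (loss_meas : forall i, measurable_fun [set: (F * Z)%type]
                            (fun p => loss i p.1 p.2))
  (loss01 : forall i f z, 0 <= loss i f z <= 1)
  (m : 'I_n -> nat) (m_ge1 : forall i, (1 <= m i)%N)
  (* the sampling: a probability space Omega carrying the samples z i j *)
  (Omega : measurableType dO) (PS : probability Omega R)
  (z : forall i : 'I_n, 'I_(m i) -> Omega -> Z)
  (z_meas : forall i j, measurable_fun [set: Omega] (z i j))
  (* all z i j mutually independent, z i j ~ D i *)
  (z_iid : forall A : forall i : 'I_n, 'I_(m i) -> set Z,
      (forall i j, measurable (A i j)) ->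
      fine (PS [set w | forall i j, A i j (z i j w)]) =
        \prod_(i < n) \prod_(j < m i) fine (D i (A i j)))
  (* the hyper-prior and the induced measure frakP *)
  (calP : probability (pprobability F R) R)
  (frakP : probability (pprobability F R * n.-tuple F)%type R)
  (frakP_def : is_hyper_mixture calP frakP)
  (delta lambda : R) (delta_gt0 : 0 < delta) (lambda_gt0 : 0 < lambda) :
  let M : R := (\sum_(i < n) m i)%:R in
  exists E : set Omega, measurable E /\ (PS E >= (1 - delta)%:E)%E /\
    forall w, E w ->
    forall (calQ : probability (pprobability F R) R)
           (Q : 'I_n -> probability F R)
           (frakQ : probability (pprobability F R * n.-tuple F)%type R),
      is_hyper_product calQ Q frakQ ->
      let RS := \sum_(i < n) (m i)%:R / M * risk (D i) (loss i) (Q i) in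
      let RhatS := \sum_(i < n) (m i)%:R / M *
                     emp_risk (loss i) (Q i) (fun j => z i j w) in
      ((- (M / lambda) * ln (1 - RS + RS * expR (- (lambda / M))))%:E <=
        RhatS%:E + (KL frakQ frakP + (ln (delta^-1))%:E) * (lambda^-1)%:E)%E.
Proof.
move=> M.
(* The index set is that of all pairs of a task and one of its samples, so the weights [m i / M]
   become a uniform average over [K]. The parameter [t] consists of a prior and [n] functions, and
   the loss of a sample reads only the function of its task. *)
pose K : finType := {i : 'I_n & 'I_(m i)}.
pose X (k : K) := z (tag k) (tagged k).
pose L (k : K) (t : (pprobability F R * n.-tuple F)%type) (x : Z) :=
  loss (tag k) (tnth t.2 (tag k)) x.
have mX k : measurable_fun setT (X k) by exact: z_meas.
have sumK (f : 'I_n -> R) : \sum_(k : K) f (tag k) = \sum_i (m i)%:R * f i.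
  rewrite -(sig_big_dep xpredT (fun _ => xpredT) (fun i (_ : 'I_(m i)) => f i))/=.
  by apply: eq_bigr => i _; rewrite sumr_const card_ord mulr_natl.
have cardK : #|K|%:R = M.
  rewrite -sumr_const (sumK (fun=> 1)) /M natr_sum.
  by apply: eq_bigr => i _; rewrite mulr1.
have indepX (A : K -> set Z) : (forall k, measurable (A k)) ->
    PS [set w | forall k, A k (X k w)] =
    (\prod_k fine (D (tag k) (A k)))%:E.
  move=> mA; have mE := measurable_forall_preimage mX mA.
  rewrite -(fineK (fin_num_measure PS _ mE)); congr EFin.
  transitivity (fine (PS [set w | forall i j, A (Tagged _ j) (z i j w)])).
    congr (fine (PS _)); apply/seteqP; split=> w /= wA.
      by move=> i j; exact: (wA (Tagged _ j)).
    by case=> i j; exact: wA.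
  rewrite (z_iid (fun i j => A (Tagged _ j))); last by move=> i j; exact: mA.
  rewrite (sig_big_dep xpredT (fun _ => xpredT)
    (fun i (j : 'I_(m i)) => fine (D i (A (Tagged _ j)))))/=.
  by apply: eq_bigr => -[].
have mL k : measurable_fun setT
    (fun p : (pprobability F R * n.-tuple F) * Z => L k p.1 p.2).
  apply: (measurableT_comp (loss_meas (tag k))
    (g := fun p : (pprobability F R * n.-tuple F) * Z =>
          (tnth p.1.2 (tag k), p.2))).
  apply: measurable_fun_pair => //.
  apply: measurableT_comp (measurable_tnth _) _.
  exact: measurableT_comp measurable_snd measurable_fst.
(* The choice [a = lambda / M] gives the stated form after division by [lambda]. No condition is put
   on [a], so [n = 0], where [lambda / M] is [0], is included. *)
have [E [mE PE bound]] :=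
  catoni_bound mX indepX mL (fun k t x => loss01 _ _ _) (lambda / M) frakP delta_gt0.
exists E; split=> //; split=> // w Ew calQ Q frakQ QE /=.
set RS := \sum_(i < n) (m i)%:R / M * risk (D i) (loss i) (Q i).
set RhatS := \sum_(i < n) (m i)%:R / M *
  emp_risk (loss i) (Q i) (fun j => z i j w).
have mloss i x : measurable_fun setT (loss i ^~ x).
  exact: measurableT_comp (loss_meas i) (pair2_measurable x).
have RSE : #|K|%:R^-1 * \sum_(k : K) \int[frakQ]_t \int[D (tag k)]_x L k t x = RS.
  rewrite (eq_bigr (fun k : K => risk (D (tag k)) (loss (tag k)) (Q (tag k)))).
    rewrite (sumK (fun i => risk (D i) (loss i) (Q i))) cardK mulr_sumr.
    by apply: eq_bigr => i _; rewrite mulrA (mulrC M^-1).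
  (* The marginal integrates over [D] inside and [Q] outside, whereas [risk] has the opposite
     order. *)
  move=> k _; rewrite (hyper_product_Rintegral (tag k)
    (g := fun f => \int[D (tag k)]_x loss (tag k) f x) QE).
  - exact: Rintegral_swap.
  - by apply: measurable_Rintegral2 => // f x; have /andP[] := loss01 (tag k) f x.
  - by move=> f; apply: Rintegral_ge0 => x _; have /andP[] := loss01 (tag k) f x.
have RhatSE : lambda / M * \sum_(k : K) \int[frakQ]_t L k t (X k w) =
    lambda * RhatS.
  rewrite (eq_bigr (fun k : K =>
      lossQ (loss (tag k)) (Q (tag k)) (z (tag k) (tagged k) w))); last first.
    move=> k _; apply: (hyper_product_Rintegral (tag k)
      (g := fun f => loss (tag k) f (X k w)) QE) => //.
    by move=> f; have /andP[] := loss01 (tag k) f (X k w).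
  rewrite -(sig_big_dep xpredT (fun _ => xpredT)
    (fun i j => lossQ (loss i) (Q i) (z i j w)))/= -mulrA mulr_sumr.
  (* The weight [m i] cancels the normalization inside [emp_risk], as [m i] is nonzero, so each
     sample has weight [1 / M]. *)
  congr (_ * _); apply: eq_bigr => i _.
  by rewrite /emp_risk mulrACA mulfV ?mul1r// pnatr_eq0 -lt0n.
have /= := bound w Ew frakQ; rewrite RSE RhatSE cardK.
have lV0 : (0 <= (lambda^-1)%:E)%E by rewrite lee_fin invr_ge0 ltW.
move=> /(lee_wpmul2r lV0); rewrite muleDl// -!EFinM.
rewrite [lambda * RhatS]mulrC mulfK ?gt_eqF//.
by rewrite mulNr -mulrA (mulrC (ln _)) mulrA -mulNr.
Qed.
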